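(* Let $b\ge2$, $s\ge1$, and $u\ge0$ be integers and let $\boldsymbol{e}=(e_1,\ldots,e_s)\in\mathbb{N}^s$ be an $s$-tuple of positive integers. Then any $(u,\boldsymbol{e},s)$-sequence in base $b$ is a $(t,s)$-sequence in base $b$ with $$t=u+\sum_{i=1}^s(e_i-1).$$
   Context: Point sets are counted with multiplicity: for a point set $\mathcal{P}$ (finite indexed family), $A(J;\mathcal{P})$ is the number of indices $n$ with $\boldsymbol{x}_n\in J$. For integers $0\le u\le m$, a *$(u,m,\boldsymbol{e},s)$-net in base $b$* is a point set $\mathcal{P}$ of $b^m$ points in $[0,1)^s$ such that $A(J;\mathcal{P})=b^m\,\mathrm{Vol}(J)$ for every interval $J=\prod_{i=1}^s[a_ib^{-d_i},(a_i+1)b^{-d_i})$ with integers $d_i\ge0$, $0\le a_i<b^{d_i}$, $e_i\mid d_i$ for $1\le i\le s$, and $\mathrm{Vol}(J)\ge b^{u-m}$. For integers $0\le t\le m$, a *$(t,m,s)$-net in base $b$* is a point set of $b^m$ points in $[0,1)^s$ such that every interval $\prod_{i=1}^s[a_ib^{-d_i},(a_i+1)b^{-d_i})$ with integers $d_i\ge0$, $0\le a_i<b^{d_i}$ and volume $b^{t-m}$ contains exactly $b^t$ of the points. A sequence $\boldsymbol{x}_0,\boldsymbol{x}_1,\ldots$ of points in $[0,1]^s$ is a *$(u,\boldsymbol{e},s)$-sequence in base $b$* (resp. a *$(t,s)$-sequence in base $b$* ) if for all integers $k\ge0$ and $m>u$ (resp. $m>t$) the points $[\boldsymbol{x}_n]_{b,m}$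 with $kb^m\le n<(k+1)b^m$ form a $(u,m,\boldsymbol{e},s)$-net (resp. a $(t,m,s)$-net) in base $b$. Here $[\boldsymbol{x}_n]_{b,m}$ is the coordinatewise $m$-digit truncation in base $b$, taken with respect to a fixed prescribed base-$b$ digit expansion $\sum_{j\ge1}x_jb^{-j}$ of each coordinate (expansions with $x_j=b-1$ for all large $j$ are allowed). *)

(* Defs.v *)
From HB Require Import structures.
From mathcomp Require Import all_boot all_order all_algebra.
From mathcomp Require Import boolp classical_sets functions reals.
From mathcomp Require Import topology normedtype sequences.

Set Implicit Arguments.
Unset Strict Implicit.
Unset Printing Implicit Defensive.

Import Order.TTheory GRing.Theory Num.Theory.
Import numFieldNormedType.Exports.

Local Open Scope classical_set_scope.
Local Open Scope ring_scope.

(* The half-open box [lo_1, hi_1) x ... x [lo_s, hi_s) and its volume. The    *)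
(* volume is only meant for boxes with lo_i <= hi_i.                          *)
Definition box (R : realType) (s : nat) (lo hi : 'rV[R]_s) : {pred 'rV[R]_s} :=
  [pred x : 'rV[R]_s | [forall i, lo 0 i <= x 0 i < hi 0 i]].

Definition box_vol (R : realType) (s : nat) (lo hi : 'rV[R]_s) : R :=
  \prod_(i < s) (hi 0 i - lo 0 i).

Definition elem_lo (R : realType) (s b : nat) (d a : 'I_s -> nat) : 'rV[R]_s :=
  \row_i ((a i)%:R * b%:R ^- d i).

Definition elem_hi (R : realType) (s b : nat) (d a : 'I_s -> nat) : 'rV[R]_s :=
  \row_i ((a i).+1%:R * b%:R ^- d i).

Definition elem_box (R : realType) (s b : nat) (d a : 'I_s -> nat) :
  {pred 'rV[R]_s} := box (elem_lo R b d a) (elem_hi R b d a).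

Definition elem_vol (R : realType) (s b : nat) (d a : 'I_s -> nat) : R :=
  box_vol (elem_lo R b d a) (elem_hi R b d a).

(* A(J; P): indices are counted, so repeated points count with multiplicity.  *)
Definition count_in (R : realType) (s N : nat) (J : {pred 'rV[R]_s})
  (P : 'I_N -> 'rV[R]_s) : nat := #|[pred n : 'I_N | P n \in J]|.

Definition in_half_open_cube (R : realType) (s : nat) (x : 'rV[R]_s) : Prop :=
  forall i, 0 <= x 0 i < 1.

Definition in_closed_cube (R : realType) (s : nat) (x : 'rV[R]_s) : Prop :=
  forall i, 0 <= x 0 i <= 1.

(* The exponent u - m is an integer, never positive under the first conjunct. *)
Definition ue_net (R : realType) (s b u m : nat) (e : 'I_s -> nat)
    (P : 'I_(b ^ m) -> 'rV[R]_s) : Prop :=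
  [/\ (u <= m)%N,
      forall n, in_half_open_cube (P n) &
      forall d a : 'I_s -> nat,
        (forall i, (a i < b ^ d i)%N) ->
        (forall i, (e i %| d i)%N) ->
        b%:R ^ (u%:Z - m%:Z) <= elem_vol R b d a ->
        (count_in (elem_box b d a) P)%:R = b%:R ^+ m * elem_vol R b d a ].

Definition t_net (R : realType) (s b t m : nat)
    (P : 'I_(b ^ m) -> 'rV[R]_s) : Prop :=
  [/\ (t <= m)%N,
      forall n, in_half_open_cube (P n) &
      forall d a : 'I_s -> nat,
        (forall i, (a i < b ^ d i)%N) ->
        elem_vol R b d a = b%:R ^ (t%:Z - m%:Z) ->
        count_in (elem_box b d a) P = (b ^ t)%N ].

(* dig j is the digit x_(j+1), the coefficient of b^-(j+1). Expansions ending *)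
(* in digits all equal to b - 1 are allowed.                                  *)
Definition digit_expansion (R : realType) (b : nat) (dig : nat -> 'I_b)
    (x : R) : Prop :=
  series (fun j : nat => (dig j)%:R * b%:R ^- j.+1 : R) @ \oo --> x.

(* [x]_(b, m), as a function of the prescribed expansions of the coordinates. *)
Definition truncation (R : realType) (s b m : nat)
    (dig : 'I_s -> nat -> 'I_b) : 'rV[R]_s :=
  \row_i \sum_(j < m) (dig i j)%:R * b%:R ^- j.+1.

Definition truncated_block (R : realType) (s b k m : nat)
    (dig : nat -> 'I_s -> nat -> 'I_b) (n : 'I_(b ^ m)) : 'rV[R]_s :=
  truncation R m (dig (k * b ^ m + n)%N).

Definition prescribed_sequence (R : realType) (s b : nat) (x : nat -> 'rV[R]_s)
    (dig : nat -> 'I_s -> nat -> 'I_b) : Prop :=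
  forall n, in_closed_cube (x n) /\
    forall i, digit_expansion (dig n i) (x n 0 i).

Definition ue_sequence (R : realType) (s b u : nat) (e : 'I_s -> nat)
    (x : nat -> 'rV[R]_s) (dig : nat -> 'I_s -> nat -> 'I_b) : Prop :=
  prescribed_sequence x dig /\
  forall k m : nat, (u < m)%N -> ue_net u e (@truncated_block R s b k m dig).

Definition t_sequence (R : realType) (s b t : nat)
    (x : nat -> 'rV[R]_s) (dig : nat -> 'I_s -> nat -> 'I_b) : Prop :=
  prescribed_sequence x dig /\
  forall k m : nat, (t < m)%N -> t_net t (@truncated_block R s b k m dig).

(* Main.v *)
(** An elementary box with side lengths [b^-d_i] is the disjoint union of the
    boxes obtained by refining each [d_i] to the least multiple [d'_i] of [e_i]
    above it.  Since [d'_i <= d_i + (e_i - 1)], a box of volume [b^(t-m)] splits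
    into boxes of volume at least [b^(u-m)], each of which carries its fair
    share of the points. *)

Require Import Defs.
From mathcomp Require Import all_boot all_order all_algebra.
From mathcomp Require Import reals.

Set Implicit Arguments.
Unset Strict Implicit.
Unset Printing Implicit Defensive.

Import Order.TTheory GRing.Theory Num.Theory.

Local Open Scope ring_scope.

(** Box membership becomes a product of 0/1 factors, so that a product of sums can be expanded by
    distributivity. *)
Lemma nat_of_forall (I : finType) (p : pred I) :
  [forall i, p i] = (\prod_i p i)%N :> nat.
Proof.
case: forallP => [p_all | /forallP].
  by rewrite big1 // => i _; rewrite p_all.
rewrite negb_forall => /existsP[i /negPf pNi].
by rewrite (bigD1 i) //= pNi mul0n.
Qed.

(** Monotonicity makes the consecutive half-open intervals tile the whole range, so at most one
    summand is 1. *)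
Lemma sum_mem_consecutive (R : realDomainType) (f : nat -> R) (x : R) (K : nat) :
  {homo f : m n / (m <= n)%N >-> m <= n} ->
  (\sum_(j < K) (f j <= x < f j.+1)%R)%N = (f 0%N <= x < f K).
Proof.
move=> f_mono; elim: K => [|K IH].
  by rewrite big_ord0; case: (leP (f 0%N) x) => //= /le_gtF ->.
rewrite big_ord_recr /= IH.
have f0K := f_mono _ _ (leq0n K); have fKS := f_mono _ _ (leqnSn K).
case: (leP (f K) x) => [fKx|xfK] /=.
  by rewrite (le_trans f0K fKx) andbF.
by rewrite (lt_le_trans xfK fKS) addn0.
Qed.

Section Refinement.
Variables (R : realType) (b s : nat).
Hypothesis b_gt0 : (0 < b)%N.
Implicit Types d c a : 'I_s -> nat.

Lemma elem_volE d a : elem_vol R b d a = \prod_i b%:R ^- d i.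
Proof.
by apply: eq_bigr => i _; rewrite !mxE -mulrBl -natrB // subSnn mul1r.
Qed.

Lemma elem_side_split (d c a : nat) (x : R) :
  (a%:R * b%:R ^- d <= x < a.+1%:R * b%:R ^- d) =
  (\sum_(j < b ^ c) ((a * b ^ c + j)%:R * b%:R ^- (d + c) <= x
                     < (a * b ^ c + j).+1%:R * b%:R ^- (d + c))%R)%N :> nat.
Proof.
have b_unit : b%:R ^+ c != 0 :> R by rewrite expf_neq0 // pnatr_eq0 -lt0n.
have refine n : n%:R * b%:R ^- d = (n * b ^ c)%:R * b%:R ^- (d + c) :> R.
  by rewrite exprD invfM natrM natrX mulrACA mulrC divff // mulr1 mulrC.
rewrite !refine mulSnr.
pose f j : R := (a * b ^ c + j)%:R * b%:R ^- (d + c).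
(* Adding 0 exhibits the left endpoint as [f 0]; the right one is already [f (b ^ c)]. *)
rewrite -[X in (X)%:R * _ <= x]addn0 -(sum_mem_consecutive (f := f)).
  by apply: eq_bigr => j _; rewrite /f addnS.
move=> m n mn; rewrite ler_wpM2r ?invr_ge0 ?exprn_ge0 //.
by rewrite ler_nat leq_add2l.
Qed.

(* The offsets [j < b ^ c i] live in types depending on [i]; they are embedded
   in the single type ['I_N] so that products of sums distribute over
   non-dependent finite functions. *)
Lemma elem_box_split d c a (N := (\max_i b ^ c i)%N) (x : 'rV[R]_s) :
  (x \in elem_box b d a) =
  (\sum_(f in family (fun i (j : 'I_N) => (j < b ^ c i)%N))
     (x \in elem_box b (fun i => d i + c i) (fun i => a i * b ^ c i + f i)))%N
  :> nat.
Proof.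
rewrite /elem_box /box inE nat_of_forall.
under [RHS]eq_bigr do rewrite inE nat_of_forall.
pose F i (j : nat) : nat := ((a i * b ^ c i + j)%:R * b%:R ^- (d i + c i)
   <= x 0 i < (a i * b ^ c i + j).+1%:R * b%:R ^- (d i + c i)).
transitivity (\prod_i \sum_(j < N | (j < b ^ c i)%N) F i j)%N.
  apply: eq_bigr => i _; rewrite !mxE (elem_side_split _ (c i)).
  by rewrite (big_ord_widen N (F i)) // /N (leq_bigmax i).
rewrite bigA_distr_big_dep; apply: eq_bigr => f _.
by apply: eq_bigr => i _; rewrite !mxE.
Qed.

(** Counts add up over the refined boxes, and so do volumes: there are [b ^ c i] pieces along axis
    [i], all of equal length. *)
Lemma fair_refinement M (P : 'I_M -> 'rV[R]_s) d c a :
  (forall i, (a i < b ^ d i)%N) ->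
  (forall a', (forall i, (a' i < b ^ (d i + c i))%N) ->
     (count_in (elem_box b (fun i => d i + c i)%N a') P)%:R
       = M%:R * elem_vol R b (fun i => d i + c i)%N a') ->
  (count_in (elem_box b d a) P)%:R = M%:R * elem_vol R b d a.
Proof.
move=> a_lt fair.
pose N := (\max_i b ^ c i)%N.
pose Q i (j : 'I_N) := (j < b ^ c i)%N.
pose a' (f : {ffun 'I_s -> 'I_N}) i := (a i * b ^ c i + f i)%N.
have -> : count_in (elem_box b d a) P =
    (\sum_(f in family Q) count_in (elem_box b (fun i => d i + c i) (a' f)) P)%N.
  rewrite /count_in -sum1_card big_mkcond /=.
  under [RHS]eq_bigr do rewrite -sum1_card big_mkcond /=.
  (* Double counting: each point of the box lies in exactly one refined box. *)
  rewrite exchange_big /=; apply: eq_bigr => n _.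
  transitivity (P n \in elem_box b d a : nat).
    by rewrite [n \in _]inE; case: (_ \in _).
  rewrite (elem_box_split d c); apply: eq_bigr => f _.
  by rewrite [n \in _]inE; case: (_ \in _).
rewrite natr_sum.
transitivity (\sum_(f in family Q) M%:R * \prod_i b%:R ^- (d i + c i) : R).
  apply: eq_bigr => f /familyP fQ; rewrite fair ?elem_volE // => i.
  have /= fi : (f i < b ^ c i)%N := fQ i.
  (* The refined index stays in range: [a * b ^ c + f < (a + 1) * b ^ c <= b ^ d * b ^ c]. *)
  rewrite expnD (@leq_trans ((a i).+1 * b ^ c i)) ?leq_mul2r ?a_lt ?orbT //.
  by rewrite mulSnr ltn_add2l.
(* Distributivity read backwards reduces the total volume to one axis at a time. *)
rewrite -mulr_sumr -(bigA_distr_big_dep Q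
  (fun i _ => b%:R ^- (d i + c i) : R)) elem_volE.
congr (_ * _); apply: eq_bigr => i _.
rewrite -(big_ord_widen N (fun=> b%:R ^- (d i + c i) : R)); last first.
  exact: (leq_bigmax i).
rewrite sumr_const card_ord exprD invfM -mulrnAr -[X in _ * X]mulr_natl natrX.
by rewrite divff ?mulr1 // expf_neq0 // pnatr_eq0 -lt0n.
Qed.

End Refinement.

Lemma ue_net_t_net (R : realType) (b s u m : nat) (e : 'I_s -> nat)
    (t := (u + \sum_(i < s) (e i - 1))%N) (P : 'I_(b ^ m) -> 'rV[R]_s) :
  (1 < b)%N -> (forall i, (0 < e i)%N) -> (t <= m)%N ->
  ue_net u e P -> t_net t P.
Proof.
move=> b_gt1 e_gt0 t_le_m [u_le_m P_cube fairP]; split=> // d a a_lt vol_d.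
have b_gt0 : (0 < b)%N := ltnW b_gt1.
have bR_gt0 : 0 < b%:R :> R by rewrite ltr0n.
have bR_neq0 : b%:R != 0 :> R by rewrite gt_eqF.
have bR_gt1 : 1 < b%:R :> R by rewrite ltr1n.
have volE d' a' : elem_vol R b d' a' = b%:R ^- (\sum_(i < s) d' i)%N.
  by rewrite elem_volE prodfV prodrXr.
have dE : (\sum_(i < s) d i = m - t)%N.
  move: vol_d; rewrite volE -opprB subzn // -exprnN => /invr_inj.
  by move=> /(ieexprIn bR_gt0 (negbT (gt_eqF bR_gt1))); apply.
(* The gap from [d i] up to the next multiple of [e i], by ceiling division; [d_le] ensures that the
   subtraction does not truncate. *)
pose c i := ((d i + (e i - 1)) %/ e i * e i - d i)%N.
have d_le i : (d i <= (d i + (e i - 1)) %/ e i * e i)%N.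
  have := ltn_ceil (d i + (e i - 1)) (e_gt0 i).
  by rewrite mulSnr subn1 -addnS prednK // leq_add2r.
have c_le i : (c i <= e i - 1)%N by rewrite leq_subLR leq_trunc_div.
have sum_dc : (\sum_(i < s) (d i + c i) <= m - u)%N.
  (* By the choice of [t], [m - u] is [m - t] plus the sum of the [e i - 1]. *)
  rewrite big_split /= dE subnDA -[leqRHS](@subnK (\sum_(i < s) (e i - 1))).
    by rewrite leq_add2l; apply: leq_sum.
  by rewrite leq_subRL.
have fair_d : (count_in (elem_box b d a) P)%:R = (b ^ m)%:R * elem_vol R b d a.
  apply: (fair_refinement b_gt0 (c := c)) => // a' a'_lt; rewrite natrX fairP //.
    by move=> i; rewrite subnKC // dvdn_mull.
  rewrite volE -opprB subzn // -exprnN lef_pV2 ?posrE ?exprn_gt0 //.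
  by rewrite ler_weXn2l // ltW.
apply/eqP; rewrite -(eqr_nat R) fair_d vol_d -opprB subzn // -exprnN.
by rewrite !natrX -expfB_cond ?subKn // (negPf bR_neq0) leq_subr.
Qed.

Theorem corollary1 (R : realType) (b s u : nat) (e : 'I_s -> nat)
    (hb : (2 <= b)%N) (hs : (1 <= s)%N) (he : forall i : 'I_s, (0 < e i)%N)
    (x : nat -> 'rV[R]_s) (dig : nat -> 'I_s -> nat -> 'I_b) :
  ue_sequence u e x dig ->
  t_sequence (u + \sum_(i < s) (e i - 1))%N x dig.
Proof.
move=> [x_dig ue_blocks]; split=> // k m t_lt_m.
apply: ue_net_t_net hb he (ltnW t_lt_m) (ue_blocks k m _).
(* The blocks are nets for [m > u], which follows from [m > t] as [u <= t]. *)
exact: leq_ltn_trans (leq_addr _ _) t_lt_m.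
Qed.
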